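(* Let $(T,M)$ be a complete local ring such that no integer of $T$ is a zero divisor of $T$, $M\notin\operatorname{Ass}T$, and there exists a minimal prime ideal $P$ of $T$ with $1<\dim(T/P)<\dim T$. Put $G=\{P\in\operatorname{Spec}T \mid P\subseteq Q\text{ for some }Q\in\operatorname{Ass}T\}$. Let $A$ be a noncatenary local integral domain with $\widehat{A}\cong T$ such that (a) for every nonzero prime ideal $P$ of $A$, $T\otimes_A k(P)\cong k(P)$; (b) $\{P\in\operatorname{Spec}T \mid P\cap A=(0)\}=G$; and (c) for every nonzero ideal $I$ of $A$, the ring $A/I$ is complete. Then $A$ is not excellent, and $A$ is quasi-excellent if and only if $T\otimes_A L$ is regular for every purely inseparable finite field extension $L$ of $k((0))$. In particular, if $k((0))$ has characteristic zero and $T_Q$ is a regular local ring for every $Q\in G$, then $A$ is quasi-excellent.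
   Context: All rings are commutative with identity. A local ring is a Noetherian ring with a unique maximal ideal; $(T,M)$ denotes a local ring $T$ with maximal ideal $M$. The completion $\widehat{A}$ of a local ring $A$ is its completion with respect to its maximal ideal; $A$ is regarded as a subring of $T$ via $A\to\widehat{A}\cong T$. $k(P)=A_P/PA_P$ for $P\in\operatorname{Spec}A$. An integer of $T$ is an element of the prime subring of $T$ (the image of $\mathbb{Z}\to T$); ''no integer of $T$ is a zero divisor'' means that every nonzero element of the prime subring of $T$ is a nonzerodivisor in $T$. A ring is catenary if for all pairs of prime ideals $P\subsetneq Q$, all saturated chains of prime ideals between $P$ and $Q$ have the same length; otherwise it is noncatenary. A local ring $A$ is quasi-excellent if, for all $P\in\operatorname{Spec}A$, the ring $\widehat{A}\otimes_A L$ is regular for every purely inseparable finite field extension $L$ of $k(P)$. A local ring is excellent if it is quasi-excellent and universally catenary. *)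

(* Defs.v *)
From HB Require Import structures.
From mathcomp Require Import all_boot all_order all_algebra all_field.
From mathcomp Require Import boolp classical_sets ring.

Set Implicit Arguments.
Unset Strict Implicit.
Unset Printing Implicit Defensive.

Import GRing.Theory.
Local Open Scope classical_set_scope.
Local Open Scope ring_scope.

(* Quotient, completion, localization and tensor product are all built as a
   set of representatives, with operations satisfying the ring axioms up to a
   congruence, modulo that congruence.  The zero ring is not excluded. *)
Record preRing := PreRing {
  pcar :> Type;
  peq : pcar -> pcar -> Prop;
  pzero : pcar; pone : pcar;
  popp : pcar -> pcar;
  padd : pcar -> pcar -> pcar;
  pmul : pcar -> pcar -> pcar;
  peq_refl : forall x, peq x x;
  peq_sym : forall x y, peq x y -> peq y x;
  peq_trans : forall x y z, peq x y -> peq y z -> peq x z;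
  peq_opp : forall x y, peq x y -> peq (popp x) (popp y);
  peq_add : forall x x' y y', peq x x' -> peq y y' ->
    peq (padd x y) (padd x' y');
  peq_mul : forall x x' y y', peq x x' -> peq y y' ->
    peq (pmul x y) (pmul x' y');
  paddA : forall x y z, peq (padd x (padd y z)) (padd (padd x y) z);
  paddC : forall x y, peq (padd x y) (padd y x);
  padd0 : forall x, peq (padd pzero x) x;
  paddN : forall x, peq (padd (popp x) x) pzero;
  pmulA : forall x y z, peq (pmul x (pmul y z)) (pmul (pmul x y) z);
  pmulC : forall x y, peq (pmul x y) (pmul y x);
  pmul1 : forall x, peq (pmul pone x) x;
  pmulDl : forall x y z,
    peq (pmul (padd x y) z) (padd (pmul x z) (pmul y z))
}.

Section RingOfPreRing.
Variable p : preRing.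

Record pclass := PClass {
  pclass_set :> set p;
  pclassP : exists x, pclass_set = [set y | peq x y]
}.

HB.instance Definition _ := gen_eqMixin pclass.
HB.instance Definition _ := gen_choiceMixin pclass.

Definition ppi (x : p) : pclass := PClass (ex_intro _ x erefl).
Definition prepr (c : pclass) : p := projT1 (cid (pclassP c)).

Lemma pclass_inj (c d : pclass) : pclass_set c = pclass_set d -> c = d.
Proof.
by case: c => c cP; case: d => d dP /= e; subst d; congr PClass; apply: Prop_irrelevance.
Qed.

Lemma ppiP x y : ppi x = ppi y <-> peq x y.
Proof.
split=> [[e]|xy].
  have : [set z | peq y z] y by apply: peq_refl.
  by rewrite -e.
apply: pclass_inj => /=; apply/seteqP; split=> z /= h.
  by apply: peq_trans h; apply: peq_sym.
by apply: peq_trans h.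
Qed.

Lemma preprK c : ppi (prepr c) = c.
Proof. by apply: pclass_inj; rewrite /prepr; case: cid. Qed.

Lemma prepr_pi x : peq (prepr (ppi x)) x.
Proof. by apply/ppiP; rewrite preprK. Qed.

Definition qadd c d := ppi (padd (prepr c) (prepr d)).
Definition qmul c d := ppi (pmul (prepr c) (prepr d)).
Definition qopp c := ppi (popp (prepr c)).

Lemma ppi_add x y : qadd (ppi x) (ppi y) = ppi (padd x y).
Proof. by apply/ppiP/peq_add; apply: prepr_pi. Qed.
Lemma ppi_mul x y : qmul (ppi x) (ppi y) = ppi (pmul x y).
Proof. by apply/ppiP/peq_mul; apply: prepr_pi. Qed.
Lemma ppi_opp x : qopp (ppi x) = ppi (popp x).
Proof. by apply/ppiP/peq_opp; apply: prepr_pi. Qed.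

Fact qaddA : associative qadd.
Proof.
move=> x y z; rewrite -(preprK x) -(preprK y) -(preprK z) !ppi_add.
exact/ppiP/paddA.
Qed.
Fact qaddC : commutative qadd.
Proof.
by move=> x y; rewrite -(preprK x) -(preprK y) !ppi_add; apply/ppiP/paddC.
Qed.
Fact qadd0 : left_id (ppi (pzero p)) qadd.
Proof. by move=> x; rewrite -(preprK x) ppi_add; apply/ppiP/padd0. Qed.
Fact qaddN : left_inverse (ppi (pzero p)) qopp qadd.
Proof. by move=> x; rewrite -(preprK x) ppi_opp ppi_add; apply/ppiP/paddN. Qed.

HB.instance Definition _ := GRing.isZmodule.Build pclass qaddA qaddC qadd0 qaddN.

Fact qmulA : associative qmul.
Proof.
move=> x y z; rewrite -(preprK x) -(preprK y) -(preprK z) !ppi_mul.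
exact/ppiP/pmulA.
Qed.
Fact qmulC : commutative qmul.
Proof.
by move=> x y; rewrite -(preprK x) -(preprK y) !ppi_mul; apply/ppiP/pmulC.
Qed.
Fact qmul1 : left_id (ppi (pone p)) qmul.
Proof. by move=> x; rewrite -(preprK x) ppi_mul; apply/ppiP/pmul1. Qed.
Fact qmulDl : left_distributive qmul qadd.
Proof.
move=> x y z; rewrite -(preprK x) -(preprK y) -(preprK z).
rewrite ppi_add !ppi_mul ppi_add; exact/ppiP/pmulDl.
Qed.

HB.instance Definition _ :=
  GRing.Zmodule_isComPzRing.Build pclass qmulA qmulC qmul1 qmulDl.

Definition preRing_ring : comPzRingType := pclass.

Lemma ppiD x y : ppi (padd x y) = ppi x + ppi y :> preRing_ring.
Proof. by rewrite -ppi_add. Qed.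
Lemma ppiM x y : ppi (pmul x y) = ppi x * ppi y :> preRing_ring.
Proof. by rewrite -ppi_mul. Qed.
Lemma ppiN x : ppi (popp x) = - (ppi x : preRing_ring).
Proof. by rewrite -ppi_opp. Qed.
Lemma ppi0 : ppi (pzero p) = 0 :> preRing_ring. Proof. by []. Qed.
Lemma ppi1 : ppi (pone p) = 1 :> preRing_ring. Proof. by []. Qed.

End RingOfPreRing.

Definition is_ideal (R : comPzRingType) (I : set R) : Prop :=
  [/\ I 0, forall x y, I x -> I y -> I (x + y) & forall a x, I x -> I (a * x)].

Record ideal (R : comPzRingType) :=
  Ideal { ideal_set :> set R; idealP : is_ideal ideal_set }.

Definition is_prime (R : comPzRingType) (I : set R) : Prop :=
  [/\ is_ideal I, ~ I 1 & forall x y, I (x * y) -> I x \/ I y].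

(* Spec R *)
Record primeIdeal (R : comPzRingType) :=
  PrimeIdeal { prime_ideal :> ideal R; primeP : is_prime prime_ideal }.

Section IdealTheory.
Variables (R : comPzRingType) (I : ideal R).

Lemma ideal0 : ideal_set I 0. Proof. by case: (idealP I). Qed.
Lemma idealD x y : ideal_set I x -> ideal_set I y -> ideal_set I (x + y).
Proof. by case: (idealP I) => _ + _; apply. Qed.
Lemma idealMl a x : ideal_set I x -> ideal_set I (a * x).
Proof. by case: (idealP I) => _ _; apply. Qed.
Lemma idealMr a x : ideal_set I x -> ideal_set I (x * a).
Proof. by rewrite mulrC; apply: idealMl. Qed.
Lemma idealN x : ideal_set I x -> ideal_set I (- x).
Proof. by rewrite -mulN1r; apply: idealMl. Qed.
Lemma idealB x y : ideal_set I x -> ideal_set I y -> ideal_set I (x - y).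
Proof. by move=> Ix Iy; apply: idealD => //; apply: idealN. Qed.

End IdealTheory.

Section IdealConstructions.
Variable R : comPzRingType.

Definition ideal_gen_set (S : set R) : set R :=
  [set x | forall J : ideal R, S `<=` J -> ideal_set J x].

Fact ideal_gen_subproof S : is_ideal (ideal_gen_set S).
Proof.
split=> [J _|x y Sx Sy J SJ|a x Sx J SJ]; first exact: ideal0.
  by apply: idealD; [apply: Sx|apply: Sy].
by apply: idealMl; apply: Sx.
Qed.

Definition ideal_gen (S : set R) : ideal R := Ideal (ideal_gen_subproof S).

Definition ideal_mul (I J : ideal R) : ideal R :=
  ideal_gen [set z | exists x y, [/\ ideal_set I x, ideal_set J y & z = x * y]].

Fixpoint ideal_exp (I : ideal R) (n : nat) : ideal R :=
  if n is n'.+1 then ideal_mul I (ideal_exp I n') else ideal_gen setT.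

Definition generated_by (I : ideal R) (s : seq R) : Prop :=
  ideal_set I = ideal_set (ideal_gen [set x | x \in s]).

Definition noetherian : Prop := forall I : ideal R, exists s, generated_by I s.

Definition maximal_ideal (I : ideal R) : Prop :=
  ~ ideal_set I 1 /\
  forall J : ideal R, ~ ideal_set J 1 -> I `<=` J -> J `<=` I.

(* (R, M) is a local ring; Noetherianity is part of the definition. *)
Definition local_ring (M : ideal R) : Prop :=
  [/\ noetherian, maximal_ideal M &
      forall N : ideal R, maximal_ideal N -> ideal_set N = ideal_set M].

Definition minimal_prime (P : primeIdeal R) : Prop :=
  forall Q : primeIdeal R, Q `<=` P -> P `<=` Q.

Definition Ass : set (set R) :=
  [set P | is_prime P /\ exists x, P = [set a | a * x = 0]].

(* c 0 < c 1 < ... < c n; the values of c beyond n are irrelevant. *)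
Definition prime_chain (c : nat -> primeIdeal R) (n : nat) : Prop :=
  forall i, (i < n)%N -> c i `<` c i.+1.

Definition saturated_chain (c : nat -> primeIdeal R) (n : nat) : Prop :=
  prime_chain c n /\
  forall i, (i < n)%N ->
    ~ exists Q : primeIdeal R, c i `<` Q /\ Q `<` c i.+1.

Definition saturated_between (P Q : primeIdeal R) (n : nat) : Prop :=
  exists c, [/\ saturated_chain c n, c 0%N = P & c n = Q].

Definition catenary : Prop :=
  forall P Q : primeIdeal R, P `<` Q ->
  forall m n, saturated_between P Q m -> saturated_between P Q n -> m = n.

(* dim R = d; Krull dimension is always finite for local rings. *)
Definition krull_dim (d : nat) : Prop :=
  (exists c, prime_chain c d) /\
  forall c n, prime_chain c n -> (n <= d)%N.

Definition min_generators (I : ideal R) (d : nat) : Prop :=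
  (exists2 s, generated_by I s & size s = d) /\
  forall s, generated_by I s -> (d <= size s)%N.

Definition regular_local : Prop :=
  exists M : ideal R, local_ring M /\
  exists d, krull_dim d /\ min_generators M d.

End IdealConstructions.

Arguments Ass : clear implicits.
Arguments noetherian : clear implicits.
Arguments catenary : clear implicits.
Arguments krull_dim : clear implicits.
Arguments regular_local : clear implicits.

Definition ext_ideal (R S : comPzRingType) (f : R -> S) (I : ideal R) : ideal S :=
  ideal_gen (f @` I).

Section Quotient.
Variables (R : comPzRingType) (I : ideal R).

Definition quot_eq (x y : R) := ideal_set I (x - y).

Definition quot_preRing : preRing.
Proof.
refine (@PreRing R quot_eq 0 1 -%R +%R *%R _ _ _ _ _ _ _ _ _ _ _ _ _ _);
  rewrite /quot_eq.
- by move=> x; rewrite subrr; apply: ideal0.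
- by move=> x y h; rewrite -opprB; apply: idealN.
- by move=> x y z h k; rewrite -(subrKA y); apply: idealD.
- by move=> x y h; rewrite -opprD; apply: idealN.
- by move=> x x' y y' h k; rewrite opprD addrACA; apply: idealD.
- move=> x x' y y' h k.
  have -> : x * y - x' * y' = (x - x') * y + x' * (y - y').
    by rewrite mulrBl mulrBr addrA subrK.
  by apply: idealD; [apply: idealMr|apply: idealMl].
- by move=> x y z; rewrite addrA subrr; apply: ideal0.
- by move=> x y; rewrite [x + y]addrC subrr; apply: ideal0.
- by move=> x; rewrite add0r subrr; apply: ideal0.
- by move=> x; rewrite addNr subrr; apply: ideal0.
- by move=> x y z; rewrite mulrA subrr; apply: ideal0.
- by move=> x y; rewrite [x * y]mulrC subrr; apply: ideal0.
- by move=> x; rewrite mul1r subrr; apply: ideal0.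
- by move=> x y z; rewrite mulrDl subrr; apply: ideal0.
Defined.

Definition quot_ring : comPzRingType := preRing_ring quot_preRing.

Definition quot_map (x : R) : quot_ring := ppi (x : quot_preRing).

Fact quot_map_additive : zmod_morphism quot_map.
Proof. by move=> x y; rewrite /quot_map (@ppiD quot_preRing) (@ppiN quot_preRing). Qed.
Fact quot_map_multiplicative : monoid_morphism quot_map.
Proof. by split=> // x y; apply: (@ppiM quot_preRing). Qed.

HB.instance Definition _ :=
  GRing.isZmodMorphism.Build R quot_ring quot_map quot_map_additive.
HB.instance Definition _ :=
  GRing.isMonoidMorphism.Build R quot_ring quot_map quot_map_multiplicative.

End Quotient.

(* The I-adic completion: Cauchy sequences modulo null sequences. *)
Section Completion.
Variables (R : comPzRingType) (I : ideal R).

Definition adic_cauchy (a : nat -> R) : Prop :=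
  forall n, exists N, forall i j, (N <= i)%N -> (N <= j)%N ->
    ideal_set (ideal_exp I n) (a i - a j).

Definition adic_null (a : nat -> R) : Prop :=
  forall n, exists N, forall i, (N <= i)%N -> ideal_set (ideal_exp I n) (a i).

Record cauchy_seq := CauchySeq {
  cauchy_fun :> nat -> R; cauchyP : adic_cauchy cauchy_fun }.

Fact cauchy_const_subproof (x : R) : adic_cauchy (fun=> x).
Proof. by move=> n; exists 0%N => i j _ _; rewrite subrr; apply: ideal0. Qed.

Fact cauchy_opp_subproof (a : cauchy_seq) : adic_cauchy (fun i => - a i).
Proof.
move=> n; case: (cauchyP a n) => N h; exists N => i j Ni Nj.
by rewrite -opprD; apply: idealN; apply: h.
Qed.

Fact cauchy_add_subproof (a b : cauchy_seq) : adic_cauchy (fun i => a i + b i).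
Proof.
move=> n; case: (cauchyP a n) => N h; case: (cauchyP b n) => N' h'.
exists (maxn N N') => i j; rewrite !geq_max => /andP[? ?] /andP[? ?].
by rewrite opprD addrACA; apply: idealD; [apply: h|apply: h'].
Qed.

Fact cauchy_mul_subproof (a b : cauchy_seq) : adic_cauchy (fun i => a i * b i).
Proof.
move=> n; case: (cauchyP a n) => N h; case: (cauchyP b n) => N' h'.
exists (maxn N N') => i j; rewrite !geq_max => /andP[? ?] /andP[? ?].
have -> : a i * b i - a j * b j = (a i - a j) * b i + a j * (b i - b j).
  by rewrite mulrBl mulrBr addrA subrK.
by apply: idealD; [apply: idealMr; apply: h|apply: idealMl; apply: h'].
Qed.

Definition cauchy_eq (a b : cauchy_seq) := adic_null (fun i => a i - b i).

Fact cauchy_eq_ext (a b : cauchy_seq) : (forall i, a i = b i) -> cauchy_eq a b.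
Proof. by move=> e n; exists 0%N => i _; rewrite e subrr; apply: ideal0. Qed.

Definition completion_preRing : preRing.
Proof.
refine (@PreRing cauchy_seq cauchy_eq
  (CauchySeq (cauchy_const_subproof 0)) (CauchySeq (cauchy_const_subproof 1))
  (fun a => CauchySeq (cauchy_opp_subproof a))
  (fun a b => CauchySeq (cauchy_add_subproof a b))
  (fun a b => CauchySeq (cauchy_mul_subproof a b)) _ _ _ _ _ _ _ _ _ _ _ _ _ _).
- by move=> a; apply: cauchy_eq_ext.
- move=> a b h n; case: (h n) => N k; exists N => i Ni.
  by rewrite -opprB; apply: idealN; apply: k.
- move=> a b c h k n; case: (h n) => N h'; case: (k n) => N' k'.
  exists (maxn N N') => i; rewrite !geq_max => /andP[? ?].
  by rewrite -(subrKA (b i)); apply: idealD; [apply: h'|apply: k'].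
- move=> a b h n; case: (h n) => N k; exists N => i Ni /=.
  by rewrite -opprD; apply: idealN; apply: k.
- move=> a a' b b' h k n; case: (h n) => N h'; case: (k n) => N' k'.
  exists (maxn N N') => i; rewrite !geq_max => /andP[? ?] /=.
  by rewrite opprD addrACA; apply: idealD; [apply: h'|apply: k'].
- move=> a a' b b' h k n; case: (h n) => N h'; case: (k n) => N' k'.
  exists (maxn N N') => i; rewrite !geq_max => /andP[? ?] /=.
  have -> : a i * b i - a' i * b' i = (a i - a' i) * b i + a' i * (b i - b' i).
    by rewrite mulrBl mulrBr addrA subrK.
  by apply: idealD; [apply: idealMr; apply: h'|apply: idealMl; apply: k'].
- by move=> a b c; apply: cauchy_eq_ext => i /=; rewrite addrA.
- by move=> a b; apply: cauchy_eq_ext => i /=; rewrite addrC.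
- by move=> a; apply: cauchy_eq_ext => i /=; rewrite add0r.
- by move=> a; apply: cauchy_eq_ext => i /=; rewrite addNr.
- by move=> a b c; apply: cauchy_eq_ext => i /=; rewrite mulrA.
- by move=> a b; apply: cauchy_eq_ext => i /=; rewrite mulrC.
- by move=> a; apply: cauchy_eq_ext => i /=; rewrite mul1r.
- by move=> a b c; apply: cauchy_eq_ext => i /=; rewrite mulrDl.
Defined.

Definition completion : comPzRingType := preRing_ring completion_preRing.

Definition completion_map (x : R) : completion :=
  ppi (CauchySeq (cauchy_const_subproof x) : completion_preRing).

Fact completion_map_additive : zmod_morphism completion_map.
Proof.
move=> x y; rewrite /completion_map.
rewrite -(@ppiN completion_preRing) -(@ppiD completion_preRing).
by apply/ppiP; apply: cauchy_eq_ext.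
Qed.
Fact completion_map_multiplicative : monoid_morphism completion_map.
Proof.
split=> // x y; rewrite /completion_map -(@ppiM completion_preRing).
by apply/ppiP; apply: cauchy_eq_ext.
Qed.

HB.instance Definition _ :=
  GRing.isZmodMorphism.Build R completion completion_map completion_map_additive.
HB.instance Definition _ :=
  GRing.isMonoidMorphism.Build R completion completion_map
    completion_map_multiplicative.

Definition adically_complete : Prop := bijective completion_map.

End Completion.

(* R_P: fractions x / s with s outside P, where x / s = y / t iff
   u (x t - y s) = 0 for some u outside P. *)
Section Localization.
Variables (R : comPzRingType) (P : primeIdeal R).

Record frac := Frac { num : R; den : R; denP : ~ ideal_set P den }.

Fact den1_subproof : ~ ideal_set P 1. Proof. by case: (primeP P). Qed.
Fact denM_subproof s t :
  ~ ideal_set P s -> ~ ideal_set P t -> ~ ideal_set P (s * t).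
Proof. by move=> Ps Pt; case: (primeP P) => _ _ h /h[]. Qed.

Definition frac_eq (x y : frac) : Prop :=
  exists2 u, ~ ideal_set P u & u * (num x * den y - num y * den x) = 0.

Definition frac_add (x y : frac) : frac :=
  @Frac (num x * den y + num y * den x) (den x * den y)
        (denM_subproof (@denP x) (@denP y)).
Definition frac_mul (x y : frac) : frac :=
  @Frac (num x * num y) (den x * den y) (denM_subproof (@denP x) (@denP y)).
Definition frac_opp (x : frac) : frac := @Frac (- num x) (den x) (@denP x).
Definition frac_of (x : R) : frac := Frac x den1_subproof.

Fact frac_eq_ext (x y : frac) : num x * den y = num y * den x -> frac_eq x y.
Proof.
by move=> e; exists 1; [exact: den1_subproof|rewrite e subrr mulr0].
Qed.

Definition frac_preRing : preRing.
Proof.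
refine (@PreRing frac frac_eq (frac_of 0) (frac_of 1) frac_opp frac_add frac_mul
  _ _ _ _ _ _ _ _ _ _ _ _ _ _).
- by move=> x; apply: frac_eq_ext.
- by move=> x y [u Pu e]; exists u; rewrite // -opprB mulrN e oppr0.
- move=> x y z [u Pu e] [v Pv e']; exists (u * v * den y).
    by apply: denM_subproof (@denP y); apply: denM_subproof.
  transitivity (v * den z * (u * (num x * den y - num y * den x)) +
    u * den x * (v * (num y * den z - num z * den y))); first by ring.
  by rewrite e e' !mulr0 addr0.
- move=> x y [u Pu e]; exists u => //=.
  by rewrite !mulNr -opprD mulrN e oppr0.
- move=> x x' y y' [u Pu e] [v Pv e']; exists (u * v); first exact: denM_subproof.
  transitivity (v * den y * den y' * (u * (num x * den x' - num x' * den x)) +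
    u * den x * den x' * (v * (num y * den y' - num y' * den y))) => /=.
    by ring.
  by rewrite e e' !mulr0 addr0.
- move=> x x' y y' [u Pu e] [v Pv e']; exists (u * v); first exact: denM_subproof.
  transitivity (v * num y * den y' * (u * (num x * den x' - num x' * den x)) +
    u * num x' * den x * (v * (num y * den y' - num y' * den y))) => /=.
    by ring.
  by rewrite e e' !mulr0 addr0.
- by move=> x y z; apply: frac_eq_ext => /=; ring.
- by move=> x y; apply: frac_eq_ext => /=; ring.
- by move=> x; apply: frac_eq_ext => /=; ring.
- by move=> x; apply: frac_eq_ext => /=; ring.
- by move=> x y z; apply: frac_eq_ext => /=; ring.
- by move=> x y; apply: frac_eq_ext => /=; ring.
- by move=> x; apply: frac_eq_ext => /=; ring.
- by move=> x y z; apply: frac_eq_ext => /=; ring.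
Defined.

Definition localization : comPzRingType := preRing_ring frac_preRing.

Definition loc_map (x : R) : localization := ppi (frac_of x : frac_preRing).

Fact loc_map_additive : zmod_morphism loc_map.
Proof.
move=> x y; rewrite /loc_map -(@ppiN frac_preRing) -(@ppiD frac_preRing).
by apply/ppiP; apply: frac_eq_ext => /=; ring.
Qed.
Fact loc_map_multiplicative : monoid_morphism loc_map.
Proof.
split=> // x y; rewrite /loc_map -(@ppiM frac_preRing).
by apply/ppiP; apply: frac_eq_ext => /=; ring.
Qed.

HB.instance Definition _ :=
  GRing.isZmodMorphism.Build R localization loc_map loc_map_additive.
HB.instance Definition _ :=
  GRing.isMonoidMorphism.Build R localization loc_map loc_map_multiplicative.

Definition loc_max : ideal localization := ext_ideal loc_map P.

Fact loc_max_num (x : frac) :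
  ideal_set loc_max (ppi (x : frac_preRing)) <-> ideal_set P (num x).
Proof.
split=> [h|Px]; last first.
  move=> J PJ; pose z : frac := @Frac 1 (den x) (@denP x).
  have -> : ppi (x : frac_preRing) =
      ppi (z : frac_preRing) * loc_map (num x) :> localization.
    rewrite /loc_map -(@ppiM frac_preRing).
    by apply/ppiP; apply: frac_eq_ext => /=; ring.
  by apply: idealMl; apply: PJ; exists (num x).
pose S : set localization :=
  [set c | exists2 y : frac, ideal_set P (num y) & c = ppi (y : frac_preRing)].
have idS : is_ideal S.
  split=> [|_ _ [y Py ->] [z Pz ->]|a _ [y Py ->]].
  - by exists (frac_of 0); first exact: ideal0.
  - exists (frac_add y z); last by rewrite (@ppiD frac_preRing).
    by apply: idealD; apply: idealMr.
  - exists (frac_mul (prepr a) y).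
      by apply: idealMl.
    by rewrite (@ppiM frac_preRing) preprK.
have [y Py /ppiP [u Pu]] : S (ppi (x : frac_preRing)).
  by apply: (h (Ideal idS)) => _ [a Pa <-]; exists (frac_of a).
move=> e; have : ideal_set P (u * (num x * den y)).
  move/eqP: e; rewrite mulrBr subr_eq0 => /eqP ->.
  by apply: idealMl; apply: idealMr.
case: (primeP P) => _ _ Pp /Pp[//|/Pp[//|]].
by move/(@denP y).
Qed.

Definition residue_field_ring : comPzRingType := quot_ring loc_max.

Definition residue : Type := residue_field_ring.
HB.instance Definition _ := GRing.ComPzRing.on residue.

Fact residue_eq0 (x : localization) :
  (quot_map loc_max x = 0) <-> ideal_set loc_max x.
Proof.
rewrite -(@ppi0 (quot_preRing loc_max)) /quot_map.
by split=> [/ppiP|h]; last apply/ppiP; rewrite /= /quot_eq subr0.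
Qed.

Fact residue_1_neq0 : (1 : residue) != 0.
Proof.
apply/eqP => /residue_eq0 /(loc_max_num (frac_of 1)).
exact: den1_subproof.
Qed.

HB.instance Definition _ :=
  GRing.PzSemiRing_isNonZero.Build residue residue_1_neq0.

Fact residue_inv_ex (x : residue) :
  exists y : residue, if x == 0 then y = 0 else y * x = 1.
Proof.
case: (eqVneq x 0) => [_|x0]; first by exists 0.
pose xl : localization := prepr (x : quot_ring loc_max).
pose xf : frac := prepr (xl : preRing_ring frac_preRing).
have xE : x = quot_map loc_max (ppi (xf : frac_preRing)).
  by rewrite /quot_map preprK preprK.
have nP : ~ ideal_set P (num xf).
  by move=> /loc_max_num /residue_eq0 h; move: x0; rewrite xE h eqxx.
exists (quot_map loc_max (ppi (@Frac (den xf) (num xf) nP : frac_preRing))).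
transitivity (quot_map loc_max (1 : localization)); last by rewrite rmorph1.
rewrite xE -(rmorphM (quot_map loc_max)); congr quot_map.
rewrite -(@ppiM frac_preRing) -(@ppi1 frac_preRing).
by apply/ppiP; apply: frac_eq_ext => /=; ring.
Qed.

Definition residue_inv (x : residue) : residue := projT1 (cid (residue_inv_ex x)).

Fact residue_mulV x : x != 0 -> residue_inv x * x = 1.
Proof. by rewrite /residue_inv; case: cid => y /=; case: eqP. Qed.
Fact residue_inv0 : residue_inv 0 = 0.
Proof. by rewrite /residue_inv; case: cid => y /=; rewrite eqxx. Qed.

HB.instance Definition _ :=
  GRing.ComNzRing_isField.Build residue residue_mulV residue_inv0.

(* k(P) = R_P / P R_P *)
Definition residue_field : fieldType := residue.

Definition residue_map (x : R) : residue_field := quot_map loc_max (loc_map x).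

Fact residue_map_additive : zmod_morphism residue_map.
Proof. by move=> x y; rewrite /residue_map rmorphB rmorphB. Qed.
Fact residue_map_multiplicative : monoid_morphism residue_map.
Proof.
by split=> [|x y]; rewrite /residue_map ?rmorph1 ?rmorph1 // rmorphM rmorphM.
Qed.

HB.instance Definition _ :=
  GRing.isZmodMorphism.Build R residue_field residue_map residue_map_additive.
HB.instance Definition _ :=
  GRing.isMonoidMorphism.Build R residue_field residue_map
    residue_map_multiplicative.

End Localization.

(* B (x)_A C: formal sums of pure tensors, modulo the congruence generated by
   biadditivity and balancedness. *)
Section Tensor.
Variables (A B C : comPzRingType) (f : {rmorphism A -> B}) (g : {rmorphism A -> C}).

Implicit Types s t : seq (B * C).

Inductive tensor_eq : seq (B * C) -> seq (B * C) -> Prop :=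
| tensor_refl s : tensor_eq s s
| tensor_sym s t : tensor_eq s t -> tensor_eq t s
| tensor_trans s t u : tensor_eq s t -> tensor_eq t u -> tensor_eq s u
| tensor_cat s s' t t' :
    tensor_eq s s' -> tensor_eq t t' -> tensor_eq (s ++ t) (s' ++ t')
| tensor_catC s t : tensor_eq (s ++ t) (t ++ s)
| tensor_0l c : tensor_eq [:: (0, c)] [::]
| tensor_Dl b b' c : tensor_eq [:: (b + b', c)] [:: (b, c); (b', c)]
| tensor_Dr b c c' : tensor_eq [:: (b, c + c')] [:: (b, c); (b, c')]
| tensor_bal a b c : tensor_eq [:: (b * f a, c)] [:: (b, g a * c)].

Definition tensor_opp s := [seq (- x.1, x.2) | x <- s].
Definition tensor_mul s t := [seq (x.1 * y.1, x.2 * y.2) | x <- s, y <- t].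

Fact tensor_eq_opp s t : tensor_eq s t -> tensor_eq (tensor_opp s) (tensor_opp t).
Proof.
elim=> {s t}.
- by move=> *; apply: tensor_refl.
- by move=> *; apply: tensor_sym.
- by move=> s t u _ h _ k; apply: tensor_trans k.
- by move=> s s' t t' _ h _ k; rewrite /tensor_opp !map_cat; apply: tensor_cat.
- by move=> s t; rewrite /tensor_opp !map_cat; apply: tensor_catC.
- by move=> c; rewrite /= oppr0; apply: tensor_0l.
- by move=> b b' c; rewrite /= opprD; apply: tensor_Dl.
- by move=> b c c' /=; apply: tensor_Dr.
- by move=> a b c /=; rewrite -mulNr; apply: tensor_bal.
Qed.

Fact tensor_mul1_eq y s t : tensor_eq s t ->
  tensor_eq [seq (x.1 * y.1, x.2 * y.2) | x <- s]
            [seq (x.1 * y.1, x.2 * y.2) | x <- t].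
Proof.
elim=> {s t}.
- by move=> *; apply: tensor_refl.
- by move=> *; apply: tensor_sym.
- by move=> s t u _ h _ k; apply: tensor_trans k.
- by move=> s s' t t' _ h _ k; rewrite !map_cat; apply: tensor_cat.
- by move=> s t; rewrite !map_cat; apply: tensor_catC.
- by move=> c; rewrite /= mul0r; apply: tensor_0l.
- by move=> b b' c; rewrite /= mulrDl; apply: tensor_Dl.
- by move=> b c c' /=; rewrite mulrDl; apply: tensor_Dr.
- by move=> a b c /=; rewrite mulrAC -[g a * c * _]mulrA; apply: tensor_bal.
Qed.

Fact tensor_mul_consl x s t :
  tensor_mul (x :: s) t =
  [seq (x.1 * y.1, x.2 * y.2) | y <- t] ++ tensor_mul s t.
Proof. by rewrite /tensor_mul allpairs_cons. Qed.

Fact tensor_mul_consr s y t :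
  tensor_eq (tensor_mul s (y :: t))
            ([seq (x.1 * y.1, x.2 * y.2) | x <- s] ++ tensor_mul s t).
Proof.
elim: s => [|x s IH]; first exact: tensor_refl.
rewrite !tensor_mul_consl !map_cons !cat_cons.
apply: (@tensor_cat [:: _] [:: _]); first exact: tensor_refl.
apply: tensor_trans (tensor_cat (tensor_refl _) IH) _.
by rewrite !catA; apply: tensor_cat (tensor_refl _); apply: tensor_catC.
Qed.

Fact tensor_mul0r s : tensor_mul s [::] = [::].
Proof. by elim: s. Qed.

Fact tensor_mul_eql s s' t :
  tensor_eq s s' -> tensor_eq (tensor_mul s t) (tensor_mul s' t).
Proof.
move=> h; elim: t => [|y t IH]; first by rewrite !tensor_mul0r; apply: tensor_refl.
apply: tensor_trans (tensor_mul_consr _ _ _) _.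
apply: tensor_trans (tensor_sym (tensor_mul_consr _ _ _)).
by apply: tensor_cat IH; apply: tensor_mul1_eq.
Qed.

Fact tensor_mulC s t : tensor_eq (tensor_mul s t) (tensor_mul t s).
Proof.
elim: t => [|y t IH]; first by rewrite tensor_mul0r; apply: tensor_refl.
apply: tensor_trans (tensor_mul_consr _ _ _) _.
rewrite tensor_mul_consl; apply: tensor_cat IH.
have -> : [seq (x.1 * y.1, x.2 * y.2) | x <- s] =
          [seq (y.1 * x.1, y.2 * x.2) | x <- s].
  by apply: eq_map => x; rewrite mulrC [x.2 * _]mulrC.
exact: tensor_refl.
Qed.

Fact tensor_mulDl s s' t :
  tensor_mul (s ++ s') t = tensor_mul s t ++ tensor_mul s' t.
Proof. by elim: s => [//|x s IH]; rewrite cat_cons !tensor_mul_consl IH catA. Qed.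

Fact tensor_mulA s t u :
  tensor_mul s (tensor_mul t u) = tensor_mul (tensor_mul s t) u.
Proof.
elim: s => [//|x s IH].
rewrite !tensor_mul_consl IH tensor_mulDl; congr (_ ++ _).
elim: t {IH} => [//|y t IHt].
rewrite map_cons !tensor_mul_consl map_cat IHt; congr (_ ++ _).
by rewrite -map_comp; apply: eq_map => z /=; rewrite !mulrA.
Qed.

Definition tensor_preRing : preRing.
Proof.
refine (@PreRing (seq (B * C)) tensor_eq [::] [:: (1, 1)] tensor_opp cat tensor_mul
  tensor_refl tensor_sym tensor_trans tensor_eq_opp tensor_cat _ _ _ _ _ _ _ _ _).
- move=> s s' t t' h k; apply: tensor_trans (tensor_mul_eql _ h) _.
  apply: tensor_trans (tensor_mulC _ _) _.
  by apply: tensor_trans (tensor_mulC _ _); apply: tensor_mul_eql.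
- by move=> s t u; rewrite catA; apply: tensor_refl.
- exact: tensor_catC.
- by move=> s; apply: tensor_refl.
- elim=> [|x s IH] /=; first exact: tensor_refl.
  apply: (@tensor_trans _ ([:: (- x.1, x.2); x] ++ (tensor_opp s ++ s))).
    apply: (@tensor_cat [:: _] [:: _]); first exact: tensor_refl.
    rewrite -(cat1s x s) catA.
    apply: (@tensor_cat _ ([:: x] ++ tensor_opp s)); first exact: tensor_catC.
    exact: tensor_refl.
  apply: (@tensor_cat _ [::] _ [::]) => //.
  case: x => b c /=; apply: tensor_trans (tensor_sym (tensor_Dl _ _ _)) _.
  by rewrite addNr; apply: tensor_0l.
- by move=> s t u; rewrite tensor_mulA; apply: tensor_refl.
- exact: tensor_mulC.
- move=> s; rewrite tensor_mul_consl cats0.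
  rewrite (eq_map (g := id)) ?map_id; first exact: tensor_refl.
  by case=> b c /=; rewrite !mul1r.
- by move=> s t u; rewrite tensor_mulDl; apply: tensor_refl.
Defined.

Definition tensor : comPzRingType := preRing_ring tensor_preRing.

Definition pure_tensor (b : B) (c : C) : tensor := ppi ([:: (b, c)] : tensor_preRing).

End Tensor.

Definition regular_ring (R : comPzRingType) : Prop :=
  noetherian R /\ forall P : primeIdeal R, regular_local (localization P).

Definition subring (R : comPzRingType) (S : set R) : Prop :=
  [/\ S 1, forall x y, S x -> S y -> S (x - y) & forall x y, S x -> S y -> S (x * y)].

Definition finitely_generated_algebra (A B : comPzRingType) (f : A -> B) : Prop :=
  exists s : seq B, forall S : set B, subring S ->
    range f `<=` S -> [set b | b \in s] `<=` S -> S = setT.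

Definition universally_catenary (A : comPzRingType) : Prop :=
  forall (B : comPzRingType) (f : {rmorphism A -> B}),
    finitely_generated_algebra f -> catenary B.

Section ResidueExtension.
Variables (A : comPzRingType) (P : primeIdeal A) (L : fieldExtType (residue_field P)).

Definition residue_ext_map : {rmorphism A -> L} := in_alg L \o residue_map P.

Definition purely_inseparable_ext : Prop :=
  purely_inseparable (1%AS : {subfield L}) {:L}.

End ResidueExtension.

Definition quasi_excellent (A : comPzRingType) (m : ideal A) : Prop :=
  forall (P : primeIdeal A) (L : fieldExtType (residue_field P)),
    purely_inseparable_ext L ->
    regular_ring (tensor (completion_map m) (residue_ext_map L)).

Definition excellent (A : comPzRingType) (m : ideal A) : Prop :=
  quasi_excellent m /\ universally_catenary A.

Section ZeroIdeal.
Variable A : idomainType.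

Fact zero_ideal_subproof : is_ideal ([set 0] : set A).
Proof.
split=> //= [x y -> ->|a x ->]; first by rewrite addr0.
by rewrite mulr0.
Qed.

Definition zero_ideal : ideal A := Ideal zero_ideal_subproof.

Fact zero_prime_subproof : is_prime zero_ideal.
Proof.
split=> /=; [exact: zero_ideal_subproof|exact/eqP/oner_neq0|].
by move=> x y /eqP; rewrite mulf_eq0 => /orP[]/eqP; [left|right].
Qed.

Definition zero_prime : primeIdeal A := PrimeIdeal zero_prime_subproof.

End ZeroIdeal.

Arguments zero_ideal : clear implicits.
Arguments zero_prime : clear implicits.

(* An element of the prime subring is z%:~R for some integer z. *)
Definition no_integer_zero_divisor (T : comPzRingType) : Prop :=
  forall z : int, z%:~R <> 0 :> T -> forall x : T, z%:~R * x = 0 -> x = 0.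

(* The primes of T lying below some associated prime. *)
Definition below_Ass (T : comPzRingType) : set (primeIdeal T) :=
  [set P | exists2 Q, Ass T Q & P `<=` Q].

Arguments below_Ass : clear implicits.

(* A -> T obtained from an identification of the completion of A with T. *)
Definition base_map (A T : comPzRingType) (m : ideal A)
    (psi : {rmorphism completion m -> T}) : {rmorphism A -> T} :=
  psi \o completion_map m.

(* T (x)_A k(P) and k(P) are isomorphic as k(P)-algebras. *)
Definition fiber_isom_residue_field (A T : comPzRingType) (f : {rmorphism A -> T})
    (P : primeIdeal A) : Prop :=
  exists phi : {rmorphism tensor f (residue_map P) -> residue_field P},
    bijective phi /\
    forall c, phi (pure_tensor f (residue_map P) 1 c) = c.

(* Main.v *)
(* Universal catenarity of A, applied to A itself, contradicts noncatenarity, so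
   A is not excellent.  For P <> 0, T (x) L = (T (x) k(P)) (x)_k(P) L is L, a
   field, hence regular; so only the fibres over (0) matter.  In characteristic
   zero a purely inseparable extension L of the fraction field is trivial, so
   T (x) L is the localization of T at the nonzero elements of A: its primes
   contract to the primes of T meeting A in 0, that is to G, and its local rings
   are the corresponding localizations of T. *)
Require Import Defs.
From HB Require Import structures.
From mathcomp Require Import all_boot all_order all_algebra all_field.
From mathcomp Require Import boolp classical_sets ring.

Set Implicit Arguments.
Unset Strict Implicit.
Unset Printing Implicit Defensive.

Import GRing.Theory.
Local Open Scope classical_set_scope.
Local Open Scope ring_scope.

(** * Extensionality for ideals and primes, generated ideals *)

Lemma ideal_eq (R : comPzRingType) (I J : ideal R) :
  ideal_set I = ideal_set J -> I = J.
Proof.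
case: I => I IP; case: J => J JP /= e; subst J.
by congr Ideal; apply: Prop_irrelevance.
Qed.

Lemma primeIdeal_eq (R : comPzRingType) (P Q : primeIdeal R) :
  ideal_set P = ideal_set Q -> P = Q.
Proof.
case: P => P PP; case: Q => Q QP /= /ideal_eq e; subst Q.
by congr PrimeIdeal; apply: Prop_irrelevance.
Qed.

Lemma ideal_gen_sub (R : comPzRingType) (A : set R) : A `<=` ideal_gen A.
Proof. by move=> x Ax J; apply. Qed.

Lemma ideal_gen_min (R : comPzRingType) (A : set R) (J : ideal R) :
  A `<=` J -> ideal_gen A `<=` J.
Proof. by move=> AJ x; apply. Qed.

(** * Contraction of ideals, and transport of regularity along ring isomorphisms *)

Section Preimage.
Variables (R S : comPzRingType) (phi : {rmorphism R -> S}).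

Fact ideal_preim_subproof (J : ideal S) : is_ideal (phi @^-1` J).
Proof.
split=> [|x y|a x] /=; first by rewrite rmorph0; apply: ideal0.
  by rewrite rmorphD; apply: idealD.
by rewrite rmorphM; apply: idealMl.
Qed.

Definition ideal_preim (J : ideal S) : ideal R := Ideal (ideal_preim_subproof J).

Fact prime_preim_subproof (Q : primeIdeal S) : is_prime (ideal_preim Q).
Proof.
case: (Defs.primeP Q) => _ Q1 QM; split=> [||x y] /=; first exact: ideal_preim_subproof.
  by rewrite rmorph1.
by rewrite rmorphM; apply: QM.
Qed.

Definition prime_preim (Q : primeIdeal S) : primeIdeal R :=
  PrimeIdeal (prime_preim_subproof Q).

End Preimage.

Section IsoTransfer.
Variables (R S : comPzRingType) (phi : {rmorphism R -> S}) (psi : {rmorphism S -> R}).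
Hypotheses (phiK : cancel phi psi) (psiK : cancel psi phi).

Lemma ideal_preimK (I : ideal R) : ideal_preim phi (ideal_preim psi I) = I.
Proof. by apply: ideal_eq; apply/seteqP; split=> x /=; rewrite phiK. Qed.

(** As [psi] is inverse to [phi], pulling back along [psi] is the same as taking the image under
    [phi], which carries generators to generators. *)
Lemma generated_by_preim (I : ideal R) s :
  generated_by I s -> generated_by (ideal_preim psi I) (map phi s).
Proof.
move=> Is; apply/seteqP; split=> [x /=|].
  rewrite Is => Ix J sJ; rewrite -(psiK x).
  apply: (ideal_gen_min (J := ideal_preim phi J) _ Ix) => y /= ys.
  exact/sJ/map_f.
apply: ideal_gen_min => _ /= /mapP[y ys ->]; rewrite phiK Is.
exact: ideal_gen_sub.
Qed.

Lemma prime_preim_proper (P Q : primeIdeal R) :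
  P `<` Q -> prime_preim psi P `<` prime_preim psi Q.
Proof.
move=> [PQ nQP]; split=> [x|QP]; first exact: PQ.
by apply: nQP => x Qx; rewrite -[x]phiK; apply: QP; rewrite /= phiK.
Qed.

Lemma maximal_ideal_preim (I : ideal R) :
  maximal_ideal I -> maximal_ideal (ideal_preim psi I).
Proof.
move=> [I1 Imax]; split=> [|J J1 IJ x Jx]; first by rewrite /= rmorph1.
apply: (Imax (ideal_preim phi J)); rewrite /= ?rmorph1 ?psiK //.
by move=> y Iy; apply: IJ; rewrite /= phiK.
Qed.

End IsoTransfer.

Section RegularLocalIso.
Variables (R S : comPzRingType) (phi : {rmorphism R -> S}) (psi : {rmorphism S -> R}).
Hypotheses (phiK : cancel phi psi) (psiK : cancel psi phi).

(** Chains of primes and generators of [M] are moved to [S] by pulling back along [psi]; the upper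
    bound on chains and the lower bound on generators hold because those of [S] pull back along
    [phi]. *)
Lemma regular_local_iso : regular_local R -> regular_local S.
Proof.
move=> [M [[noeR maxM uniqM] [d [[[c chain] dimR] [[s Ms sd] minM]]]]].
exists (ideal_preim psi M); split; last exists d; repeat split.
- move=> J; have [t Jt] := noeR (ideal_preim phi J).
  exists (map phi t); rewrite -(ideal_preimK psiK J).
  exact: generated_by_preim Jt.
- by case: (maximal_ideal_preim phiK psiK maxM).
- by case: (maximal_ideal_preim phiK psiK maxM).
- move=> N maxN; rewrite -(ideal_preimK psiK N) /=.
  by rewrite -(uniqM _ (maximal_ideal_preim psiK phiK maxN)).
- exists (fun i => prime_preim psi (c i)) => i id.
  exact/(prime_preim_proper phiK)/chain.
- move=> b n bn; apply: (dimR (fun i => prime_preim phi (b i))) => i id.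
  exact/(prime_preim_proper psiK)/bn.
- by exists (map phi s); rewrite ?size_map //; apply: generated_by_preim.
- move=> t Mt; rewrite -(size_map psi); apply: minM.
  by rewrite -(ideal_preimK phiK M); apply: generated_by_preim.
Qed.

End RegularLocalIso.

Lemma inverse_rmorphism (R S : comPzRingType) (phi : {rmorphism R -> S}) :
  bijective phi -> exists2 psi : {rmorphism S -> R}, cancel phi psi & cancel psi phi.
Proof.
case=> psi phiK psiK.
pose psiA := GRing.isZmodMorphism.Build S R psi (can2_zmod_morphism phiK psiK).
pose psiM := GRing.isMonoidMorphism.Build S R psi (can2_monoid_morphism phiK psiK).
pose psiR : {rmorphism S -> R} := HB.pack psi psiA psiM.
by exists psiR.
Qed.

(** [bijective] asks for a two-sided inverse, which choice extracts from surjectivity. *)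
Lemma inj_surj_bij (X Y : Type) (f : X -> Y) :
  injective f -> (forall y, exists x, f x = y) -> bijective f.
Proof.
move=> f_inj f_surj; pose g y := projT1 (cid (f_surj y)).
have gK : cancel g f by move=> y; rewrite /g; case: cid.
by exists g => // x; apply: f_inj.
Qed.

Lemma regular_local_bij (R S : comPzRingType) (phi : {rmorphism R -> S}) :
  bijective phi -> regular_local R -> regular_local S.
Proof. by case/inverse_rmorphism=> psi; apply: regular_local_iso. Qed.

(** * Maps induced on localizations *)

Section LocalizationFunctor.
Variables (R S : comPzRingType) (phi : {rmorphism R -> S}) (Q : primeIdeal S).
Let P := prime_preim phi Q.

Definition frac_lift (x : Defs.frac P) : Defs.frac Q :=
  @Frac S Q (phi (num x)) (phi (den x)) (@denP _ _ x).

Lemma frac_lift_eq x y : frac_eq x y -> frac_eq (frac_lift x) (frac_lift y).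
Proof.
move=> [u Pu e]; exists (phi u) => //=.
by rewrite -!rmorphM -rmorphB -rmorphM e rmorph0.
Qed.

(** The canonical map from R_P to S_Q, defined on chosen representatives; [loc_lift_pi] removes the
    dependence on the choice. *)
Definition loc_lift (x : localization P) : localization Q :=
  ppi (frac_lift (prepr x) : frac_preRing Q).

Lemma loc_lift_pi (x : Defs.frac P) :
  loc_lift (ppi (x : frac_preRing P)) = ppi (frac_lift x : frac_preRing Q).
Proof. by apply/ppiP; apply: frac_lift_eq; apply: (@prepr_pi (frac_preRing P)). Qed.

Fact loc_lift_additive : zmod_morphism loc_lift.
Proof.
move=> x y; rewrite -(preprK x) -(preprK y) -(@ppiN (frac_preRing P)).
rewrite -(@ppiD (frac_preRing P)) !loc_lift_pi -(@ppiN (frac_preRing Q)).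
rewrite -(@ppiD (frac_preRing Q)); apply/ppiP; apply: frac_eq_ext => /=.
by rewrite !(rmorphM, rmorphD, rmorphN).
Qed.

Fact loc_lift_multiplicative : monoid_morphism loc_lift.
Proof.
split=> [|x y].
  rewrite -(@ppi1 (frac_preRing P)) -(@ppi1 (frac_preRing Q)) loc_lift_pi.
  by apply/ppiP; apply: frac_eq_ext => /=; rewrite !rmorph1.
rewrite -(preprK x) -(preprK y) -(@ppiM (frac_preRing P)) !loc_lift_pi.
rewrite -(@ppiM (frac_preRing Q)); apply/ppiP; apply: frac_eq_ext => /=.
by rewrite !rmorphM.
Qed.

HB.instance Definition _ := GRing.isZmodMorphism.Build (localization P)
  (localization Q) loc_lift loc_lift_additive.
HB.instance Definition _ := GRing.isMonoidMorphism.Build (localization P)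
  (localization Q) loc_lift loc_lift_multiplicative.

End LocalizationFunctor.

(* Covers both isomorphisms and localizations at a multiplicative set; the
   second clause only asks the kernel to vanish in every localization of R at
   a prime pulled back from S. *)
Definition localization_like (R S : comPzRingType) (phi : R -> S) : Prop :=
  (forall b : S, exists t w v, v * phi w = 1 /\ phi w * b = phi t) /\
  (forall (Q : primeIdeal S) x, phi x = 0 ->
     exists2 v, ~ ideal_set Q (phi v) & v * x = 0).

Lemma prime_unit (R : comPzRingType) (P : primeIdeal R) (u v : R) :
  v * u = 1 -> ~ ideal_set P u.
Proof.
by case: (Defs.primeP P) => _ P1 _ vu Pu; apply: P1; rewrite -vu; apply: idealMl.
Qed.

Section LocalizationLike.
Variables (R S : comPzRingType) (phi : {rmorphism R -> S}).
Hypothesis phi_loc : localization_like phi.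

(** Each element of [J] is a unit times some [phi t] with [t] in the contraction of [J], so the
    images of generators of the contraction generate [J]. *)
Lemma noetherian_loc_like : noetherian R -> noetherian S.
Proof.
move=> noeR J; have [s Js] := noeR (ideal_preim phi J); exists (map phi s).
apply/seteqP; split=> [b Jb|]; last first.
  apply: ideal_gen_min => _ /= /mapP[y ys ->].
  suff: ideal_set (ideal_preim phi J) y by [].
  by rewrite Js; apply: ideal_gen_sub.
have [t [w [v [vw wb]]]] := phi_loc.1 b.
have -> : b = v * phi t by rewrite -wb mulrA vw mul1r.
apply: idealMl => K sK.
have : ideal_set (ideal_preim phi J) t by rewrite /= -wb; apply: idealMl.
rewrite Js => /(_ (ideal_preim phi K)); apply => y /= ys.
exact/sK/map_f.
Qed.

(** Elements of [S] are unit multiples of images from [R], which gives surjectivity; injectivity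
    comes from the kernel clause. *)
Lemma loc_lift_bij (Q : primeIdeal S) : bijective (loc_lift (phi := phi) (Q := Q)).
Proof.
have [fracS kerS] := phi_loc.
have QM := denM_subproof (P := Q).
apply: inj_surj_bij => [|y].
  apply: raddf_inj => x /=; rewrite -(preprK x) loc_lift_pi.
  rewrite -(@ppi0 (frac_preRing _)) -(@ppi0 (frac_preRing (prime_preim phi Q))).
  move/ppiP => [u Qu] /=; rewrite mulr1 mul0r subr0 => ux.
  (* The annihilator [u] lies in [S] only; multiplied by the unit [phi w] it becomes the image of
     some [t], still outside [Q]. *)
  have [t [w [v [vw wu]]]] := fracS u.
  have Qt : ~ ideal_set Q (phi t) by rewrite -wu; apply: QM => //; apply: prime_unit vw.
  have [|z Qz ztx] := kerS Q (t * num (prepr x)).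
    by rewrite rmorphM -wu -mulrA ux mulr0.
  apply/ppiP; exists (z * t); first by rewrite /= rmorphM; apply: QM.
  by rewrite /= mulr1 mul0r subr0 -mulrA.
rewrite -(preprK y); set z := prepr y.
have [t [w [v [vw wn]]]] := fracS (num z).
have [t' [w' [v' [vw' wd]]]] := fracS (den z).
(* Since [num z] is phi t / phi w and [den z] is phi t' / phi w', the fraction to hit comes from w'
   t / (w t'). *)
have Pd : ~ ideal_set (prime_preim phi Q) (w * t').
  rewrite /= rmorphM -wd; apply: (QM); first exact: prime_unit vw.
  by apply: QM; [exact: prime_unit vw'|exact: denP].
exists (ppi (Frac (w' * t) Pd : frac_preRing _)); rewrite loc_lift_pi.
apply/ppiP; apply: frac_eq_ext => /=; rewrite !rmorphM -wd -wn; ring.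
Qed.

Lemma regular_local_loc_like (Q : primeIdeal S) :
  regular_local (localization (prime_preim phi Q)) -> regular_local (localization Q).
Proof. exact: regular_local_bij (loc_lift_bij Q). Qed.

End LocalizationLike.

Lemma bij_localization_like (R S : comPzRingType) (phi : {rmorphism R -> S}) :
  bijective phi -> localization_like phi.
Proof.
case=> psi phiK psiK; split=> [b|Q x phix].
  by exists (psi b), 1, 1; rewrite rmorph1 !mul1r psiK.
exists 1; first by rewrite rmorph1; case: (Defs.primeP Q).
by rewrite mul1r -(phiK x) phix -(rmorph0 phi) phiK.
Qed.

Lemma regular_ring_bij (R S : comPzRingType) (phi : {rmorphism R -> S}) :
  bijective phi -> regular_ring R -> regular_ring S.
Proof.
move=> /bij_localization_like phi_loc [noeR regR]; split.
  exact: (noetherian_loc_like phi_loc).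
by move=> Q; apply: (regular_local_loc_like phi_loc).
Qed.

(** * Fields are regular rings *)

Definition field_like (R : comPzRingType) : Prop :=
  1 <> 0 :> R /\ forall x : R, x <> 0 -> exists y, y * x = 1.

Section FieldLike.
Variable R : comPzRingType.
Hypothesis R_field : field_like R.

Lemma field_like_ideal (I : ideal R) : ~ ideal_set I 1 -> ideal_set I = [set 0].
Proof.
move=> I1; apply/seteqP; split=> [x Ix /=|x ->]; last exact: ideal0.
apply: contrapT => /R_field.2[y yx]; apply: I1.
by rewrite -yx; apply: idealMl.
Qed.

Lemma field_like_prime (P : primeIdeal R) : ideal_set P = [set 0].
Proof. by apply: field_like_ideal; case: (Defs.primeP P). Qed.

Fact field_like_zero_subproof : is_prime ([set 0] : set R).
Proof.
split; last first.
- move=> x y /= xy; case: (pselect (x = 0)) => [|/R_field.2[z zx]]; first by left.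
  by right; rewrite -(mul1r y) -zx -mulrA xy mulr0.
- exact: R_field.1.
- by split=> //= [x y -> ->|a x ->]; rewrite ?addr0 ?mulr0.
Qed.

Lemma noetherian_field_like : noetherian R.
Proof.
move=> I; case: (pselect (ideal_set I 1)) => [I1|/field_like_ideal I0].
  exists [:: 1]; apply/seteqP; split=> [x _|].
    by rewrite -[x]mulr1; apply: idealMl; apply: ideal_gen_sub => /=; rewrite inE.
  by apply: ideal_gen_min => x /=; rewrite inE => /eqP->.
exists [::]; rewrite /generated_by I0; apply/seteqP; split=> [x ->|].
  exact: ideal0.
have -> : [set 0] = ideal_set I by [].
exact: ideal_gen_min.
Qed.

(** Zero is the only prime: the dimension is 0 and the empty list generates the maximal ideal. *)
Lemma regular_local_field_like : regular_local R.
Proof.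
have primeM := field_like_zero_subproof; have [idM _ _] := primeM.
pose M := Ideal idM; pose PM := @PrimeIdeal _ M primeM.
have M1 : ~ ideal_set M 1 by exact: R_field.1.
exists M; split; [split=> //|exists 0%N; split; split=> //].
- exact: noetherian_field_like.
- by split=> // J /field_like_ideal -> .
- by move=> N [/field_like_ideal -> _].
- by exists (fun=> PM).
- move=> c [//|n] /(_ 0%N isT) [_]; case.
  by rewrite (field_like_prime (c 1%N)) => x ->; apply: ideal0.
- exists [::] => //; apply/seteqP; split=> [x ->|]; first exact: ideal0.
  exact: ideal_gen_min.
Qed.

(** As [P] is zero, a nonzero numerator is a legitimate denominator, so a nonzero fraction can be
    turned upside down. *)
Lemma localization_field_like (P : primeIdeal R) : field_like (localization P).
Proof.
have P0 := field_like_prime P; split.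
  rewrite -(@ppi1 (frac_preRing P)) -(@ppi0 (frac_preRing P)) => /ppiP[u Pu] /=.
  rewrite mul0r subr0 !mulr1 => u0.
  by apply: Pu; rewrite u0; apply: ideal0.
move=> x; rewrite -(preprK x); set z := prepr x => z0.
have n0 : num z <> 0.
  move=> n0; apply: z0; rewrite -(@ppi0 (frac_preRing P)).
  by apply/ppiP; apply: frac_eq_ext; rewrite /= n0 !mul0r.
have Pn : ~ ideal_set P (num z) by rewrite P0.
exists (ppi (Frac (den z) Pn : frac_preRing P)).
rewrite -(@ppi1 (frac_preRing P)) -(@ppiM (frac_preRing P)).
by apply/ppiP; apply: frac_eq_ext => /=; ring.
Qed.

End FieldLike.

(** Meant for the rings [tensor f g], which carry only a ring structure; hence being a field is a
    predicate here. *)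
Lemma regular_ring_field_like (R : comPzRingType) : field_like R -> regular_ring R.
Proof.
move=> R_field; split=> [|P]; first exact: noetherian_field_like.
exact/regular_local_field_like/localization_field_like.
Qed.

(** * Tensor products: balanced maps, pure tensors, functoriality *)

Section TensorSum.
Variables (A B C : comPzRingType) (f : {rmorphism A -> B}) (g : {rmorphism A -> C}).
Variables (V : zmodType) (v : B -> C -> V).
Hypotheses (vDl : forall b b' c, v (b + b') c = v b c + v b' c)
  (vDr : forall b c c', v b (c + c') = v b c + v b c')
  (v_bal : forall a b c, v (b * f a) c = v b (g a * c)).

(** The universal property in the form needed later: an equation between tensors yields one between
    the values of any balanced biadditive map. *)
Lemma tensor_eq_sum s t : tensor_eq f g s t ->
  \sum_(x <- s) v x.1 x.2 = \sum_(x <- t) v x.1 x.2.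
Proof.
elim=> {s t} //= [s t u _ -> _ ->|s s' t t' _ h _ k|s t|c|b b' c|b c c'|a b c] //.
- by rewrite !big_cat /= h k.
- by rewrite !big_cat /= addrC.
- rewrite big_seq1 big_nil /=; apply: (@addrI _ (v 0 c)).
  by rewrite -vDl !addr0.
- by rewrite big_seq1 big_cons big_seq1 vDl.
- by rewrite big_seq1 big_cons big_seq1 vDr.
- by rewrite !big_seq1 v_bal.
Qed.

End TensorSum.

Section PureTensor.
Variables (A B C : comPzRingType) (f : {rmorphism A -> B}) (g : {rmorphism A -> C}).
Local Notation pt := (pure_tensor f g).

Lemma pure_tensorM b b' c c' : pt b c * pt b' c' = pt (b * b') (c * c').
Proof. by rewrite /pure_tensor -(@ppiM (tensor_preRing f g)). Qed.

Lemma pure_tensorDl b b' c : pt (b + b') c = pt b c + pt b' c.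
Proof.
rewrite /pure_tensor -(@ppiD (tensor_preRing f g)).
by apply/ppiP; apply: tensor_Dl.
Qed.

Lemma pure_tensorDr b c c' : pt b (c + c') = pt b c + pt b c'.
Proof.
rewrite /pure_tensor -(@ppiD (tensor_preRing f g)).
by apply/ppiP; apply: tensor_Dr.
Qed.

Lemma pure_tensorNl b c : pt (- b) c = - pt b c.
Proof. by rewrite /pure_tensor -(@ppiN (tensor_preRing f g)). Qed.

Lemma pure_tensor_bal a b c : pt (b * f a) c = pt b (g a * c).
Proof. by apply/ppiP; apply: tensor_bal. Qed.

Lemma pure_tensor1 : pt 1 1 = 1. Proof. by []. Qed.

Lemma pure_tensor0r b : pt b 0 = 0.
Proof. by apply: (@addrI _ (pt b 0)); rewrite -pure_tensorDr !addr0. Qed.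

Lemma tensor_ind (K : tensor f g -> Prop) :
  K 0 -> (forall b c x, K x -> K (pt b c + x)) -> forall x, K x.
Proof.
move=> K0 KD x; rewrite -(preprK x).
elim: (prepr x : seq (B * C)) => [|[b c] s IH]; first exact: K0.
have := KD b c _ IH; rewrite /pure_tensor -(@ppiD (tensor_preRing f g)).
exact.
Qed.

Fact tensor_inl_additive : zmod_morphism (pt^~ 1).
Proof. by move=> x y; rewrite pure_tensorDl pure_tensorNl. Qed.

Fact tensor_inl_multiplicative : monoid_morphism (pt^~ 1).
Proof. by split=> // x y; rewrite pure_tensorM mulr1. Qed.

(** Named so that this map can carry a ring morphism structure. *)
Definition tensor_inl (b : B) : tensor f g := pt b 1.
HB.instance Definition _ :=
  GRing.isZmodMorphism.Build B (tensor f g) tensor_inl tensor_inl_additive.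
HB.instance Definition _ :=
  GRing.isMonoidMorphism.Build B (tensor f g) tensor_inl tensor_inl_multiplicative.

End PureTensor.

Section TensorMap.
Variables (A B C B' C' : comPzRingType).
Variables (f : {rmorphism A -> B}) (g : {rmorphism A -> C}).
Variables (f' : {rmorphism A -> B'}) (g' : {rmorphism A -> C'}).
Variables (h : {rmorphism B -> B'}) (k : {rmorphism C -> C'}).
Variables (hf : forall a, h (f a) = f' a) (kg : forall a, k (g a) = g' a).

Local Notation tmap := (map (fun x : B * C => (h x.1, k x.2))).

Lemma tensor_eq_map s t : tensor_eq f g s t -> tensor_eq f' g' (tmap s) (tmap t).
Proof.
elim=> {s t} /=.
- by move=> *; apply: tensor_refl.
- by move=> *; apply: tensor_sym.
- by move=> s t u _ st _ tu; apply: tensor_trans tu.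
- by move=> s s' t t' _ ? _ ?; rewrite !map_cat; apply: tensor_cat.
- by move=> s t; rewrite !map_cat; apply: tensor_catC.
- by move=> c; rewrite rmorph0; apply: tensor_0l.
- by move=> b b' c; rewrite rmorphD; apply: tensor_Dl.
- by move=> b c c'; rewrite rmorphD; apply: tensor_Dr.
- by move=> a b c; rewrite !rmorphM hf kg; apply: tensor_bal.
Qed.

(* The two compatibility proofs are arguments only so that the ring morphism
   structure below can be inferred from the term. *)
Definition tensor_map of (forall a, h (f a) = f' a) & (forall a, k (g a) = g' a) :=
  fun x : tensor f g => ppi (tmap (prepr x) : tensor_preRing f' g') : tensor f' g'.

Lemma tensor_map_pi s :
  tensor_map hf kg (ppi (s : tensor_preRing f g)) = ppi (tmap s : tensor_preRing f' g').
Proof. by apply/ppiP; apply: tensor_eq_map; apply: (@prepr_pi (tensor_preRing f g)). Qed.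

Lemma tensor_map_pure b c :
  tensor_map hf kg (pure_tensor f g b c) = pure_tensor f' g' (h b) (k c).
Proof. exact: tensor_map_pi. Qed.

Fact tensor_map_additive : zmod_morphism (tensor_map hf kg).
Proof.
move=> x y; rewrite -(preprK x) -(preprK y) -(@ppiN (tensor_preRing f g)).
rewrite -(@ppiD (tensor_preRing f g)) !tensor_map_pi.
rewrite -(@ppiN (tensor_preRing f' g')) -(@ppiD (tensor_preRing f' g')) /=.
congr ppi; rewrite map_cat; congr (_ ++ _).
rewrite /tensor_opp -!map_comp; apply: eq_map => z /=.
by rewrite rmorphN.
Qed.

Fact tensor_map_multiplicative : monoid_morphism (tensor_map hf kg).
Proof.
split=> [|x y].
  by rewrite -!pure_tensor1 tensor_map_pure !rmorph1.
rewrite -(preprK x) -(preprK y) -(@ppiM (tensor_preRing f g)) !tensor_map_pi.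
rewrite -(@ppiM (tensor_preRing f' g')) /=; congr ppi.
rewrite /tensor_mul allpairs_mapl allpairs_mapr map_allpairs.
by apply: eq_allpairs => u w /=; rewrite !rmorphM.
Qed.

HB.instance Definition _ := GRing.isZmodMorphism.Build (tensor f g)
  (tensor f' g') (tensor_map hf kg) tensor_map_additive.
HB.instance Definition _ := GRing.isMonoidMorphism.Build (tensor f g)
  (tensor f' g') (tensor_map hf kg) tensor_map_multiplicative.

End TensorMap.

(** The maps induced by [h] and its inverse are mutually inverse on tensors. This serves to replace
    the completion of the base ring by [T]. *)
Lemma regular_tensor_bij (A B B' C : comPzRingType) (f : {rmorphism A -> B})
    (g : {rmorphism A -> C}) (h : {rmorphism B -> B'}) : bijective h ->
  regular_ring (tensor f g) <-> regular_ring (tensor (h \o f) g).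
Proof.
move=> /inverse_rmorphism[h' hK h'K].
pose up : {rmorphism _ -> _} := tensor_map (f := f) (g := g) (f' := h \o f)
  (g' := g) (h := h) (k := idfun)
  (fun=> erefl) (fun=> erefl).
pose dn : {rmorphism _ -> _} := tensor_map (f := h \o f) (g := g) (f' := f)
  (g' := g) (h := h') (k := idfun)
  (fun a => hK (f a)) (fun=> erefl).
have upK : cancel up dn.
  move=> x; elim/tensor_ind: x => [|b c x IH]; first by rewrite !rmorph0.
  by rewrite !rmorphD IH /= !tensor_map_pure /= hK.
have dnK : cancel dn up.
  move=> x; elim/tensor_ind: x => [|b c x IH]; first by rewrite !rmorph0.
  by rewrite !rmorphD IH /= !tensor_map_pure /= h'K.
split.
  by apply: (regular_ring_bij (phi := up)); exists dn.
by apply: (regular_ring_bij (phi := dn)); exists up.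
Qed.

(** * Residue fields and the fibres over nonzero primes *)

Section ResidueFractions.
Variables (A : comPzRingType) (P : primeIdeal A).

Lemma residue_map_eq0 a : residue_map P a = 0 <-> ideal_set P a.
Proof. exact: iff_trans (residue_eq0 _) (loc_max_num (frac_of P a)). Qed.

Lemma residue_frac (c : residue_field P) :
  exists n d, ~ ideal_set P d /\ residue_map P d * c = residue_map P n.
Proof.
pose x : localization P := prepr (c : quot_ring (loc_max P)).
pose y : Defs.frac P := prepr (x : preRing_ring (frac_preRing P)).
exists (num y), (den y); split; first exact: denP.
have -> : c = quot_map (loc_max P) (ppi (y : frac_preRing P)).
  by rewrite /quot_map preprK preprK.
rewrite -(rmorphM (quot_map (loc_max P))); congr quot_map.
rewrite -(@ppiM (frac_preRing P)).
by apply/ppiP; apply: frac_eq_ext => /=; ring.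
Qed.

End ResidueFractions.

(* If [t (x) 1 = 1 (x) sigma t] over k(P), the same holds over any extension L,
   so every element of [B (x) L] has the form [1 (x) l]. *)
Lemma trivial_fiber_regular (A B : comPzRingType) (f : {rmorphism A -> B})
    (P : primeIdeal A) (L : fieldExtType (residue_field P)) :
  fiber_isom_residue_field f P -> regular_ring (tensor f (residue_ext_map L)).
Proof.
move=> [phi [[phi' phiK phi'K] phi1]]; set g := residue_ext_map L.
(* The fibre isomorphism restricted to [B]; it factors the residue map of [P] through [f]. *)
pose sigma : {rmorphism B -> residue_field P} := phi \o tensor_inl f (residue_map P).
have sigmaE b : pure_tensor f (residue_map P) b 1 =
    pure_tensor f (residue_map P) 1 (sigma b).
  by apply: (can_inj phiK); rewrite phi1.
(* Base change from k(P) to [L], which carries [sigmaE] over to the fibre with coefficients in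
   [L]. *)
pose up : {rmorphism _ -> _} := tensor_map (f := f)
  (g := residue_map P) (f' := f) (g' := g) (h := idfun) (k := in_alg L) (fun=> erefl) (fun=> erefl).
have pureE b l : pure_tensor f g b l = pure_tensor f g 1 (in_alg L (sigma b) * l).
  have := congr1 up (sigmaE b); rewrite /up /= !tensor_map_pure /= scale1r => e.
  by rewrite -{1}(mulr1 b) -{1}(mul1r l) -pure_tensorM e pure_tensorM mulr1.
have allE x : exists l, x = pure_tensor f g 1 l.
  elim/tensor_ind: x => [|b c _ [l ->]]; first by exists 0; rewrite pure_tensor0r.
  by exists (in_alg L (sigma b) * c + l); rewrite pureE -pure_tensorDr.
have sigmaf a : in_alg L (sigma (f a)) = g a.
  have := pure_tensor_bal f (residue_map P) a 1 1; rewrite mul1r mulr1 => e.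
  by rewrite /sigma /= /tensor_inl e phi1.
apply: regular_ring_field_like; split=> [|x].
  (* The form sending [b], [l] to sigma(b) l is balanced by [sigmaf]. It takes 1 on the unit tensor,
     so the tensor product is not the zero ring. *)
  rewrite -pure_tensor1 -(@ppi0 (tensor_preRing f g)) => /ppiP.
  move/(tensor_eq_sum (v := fun b l => in_alg L (sigma b) * l)).
  rewrite big_seq1 big_nil [sigma _]rmorph1 rmorph1 mulr1 => e.
  suff /eqP : 1 = 0 :> L by rewrite oner_eq0.
  apply: e => [b b' c|b c c'|a b c].
  - by rewrite !rmorphD mulrDl.
  - exact: mulrDr.
  - by rewrite -sigmaf mulrA -rmorphM; congr (_ * _); rewrite -!rmorphM.
have [l ->] := allE x; case: (eqVneq l 0) => [->|l0 _].
  by rewrite pure_tensor0r.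
by exists (pure_tensor f g 1 l^-1); rewrite pure_tensorM mulr1 mulVf.
Qed.

(** * The generic fibre as a localization at the nonzero elements of [A] *)

Section GenericFiber.
Variables (A : idomainType) (B : comPzRingType) (L : fieldType).
Variables (f : {rmorphism A -> B}) (g : {rmorphism A -> L}).
Hypotheses (g_inj : forall a, g a = 0 -> a = 0)
  (g_frac : forall c, exists n d, d <> 0 /\ g d * c = g n).

(** The factor [f a] moves across the tensor sign to [g a], which is invertible in the field [L]. *)
Lemma tensor_inl_unit a : a <> 0 ->
  pure_tensor f g 1 (g a)^-1 * tensor_inl f g (f a) = 1.
Proof.
move=> a0; have ga0 : g a != 0 by apply/eqP => /g_inj.
rewrite /tensor_inl pure_tensorM mul1r mulr1 -(mul1r (f a)) pure_tensor_bal.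
by rewrite mulfV // pure_tensor1.
Qed.

Lemma prime_preim_tensor_inl (Q : primeIdeal (tensor f g)) :
  f @^-1` prime_preim (tensor_inl f g) Q = [set 0].
Proof.
apply/seteqP; split=> [a /= Qa|a -> /=]; last by rewrite !rmorph0; apply: ideal0.
by apply: contrapT => /tensor_inl_unit /(prime_unit (P := Q)).
Qed.

(** The section hypotheses make [L] the fraction field of [A]. Sums of tensors are put over a common
    denominator, and the kernel is found by evaluating tensors in a localization of [B]. *)
Lemma tensor_inl_localization_like : localization_like (tensor_inl f g).
Proof.
split=> [|Q x x0].
  apply: tensor_ind => [|b c x [t [w [v [vw wx]]]]].
    by exists 0, 1, 1; rewrite rmorph1 mulr1 mulr0 rmorph0.
  have [n [d [d0 dc]]] := g_frac c.
  (* The sum of the fractions b f(n) / f(d), for the pure tensor, and t / w, for [x], over the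
     common denominator f(d) w. *)
  exists (b * w * f n + t * f d), (f d * w), (v * pure_tensor f g 1 (g d)^-1).
  split.
    by rewrite rmorphM [X in _ * X]mulrC mulrACA vw mul1r tensor_inl_unit.
  have tE : tensor_inl f g (b * w * f n) = pure_tensor f g (b * w) (g n).
    by rewrite /tensor_inl pure_tensor_bal mulr1.
  have bcE : tensor_inl f g (f d * w) * pure_tensor f g b c =
      pure_tensor f g (b * w) (g d * c).
    rewrite /tensor_inl pure_tensorM mul1r -pure_tensor_bal.
    by congr pure_tensor; ring.
  rewrite mulrDr rmorphD; congr (_ + _); first by rewrite [RHS]tE bcE dc.
  by rewrite !rmorphM -mulrA wx mulrC.
(* It suffices that [x] vanishes in the localization of [B] at the contraction of [Q], where nonzero
   elements of [A] become units. *)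
set P := prime_preim (tensor_inl f g) Q.
have fP a : a <> 0 -> ~ ideal_set P (f a).
  by move=> a0; apply: prime_unit (tensor_inl_unit a0).
(* A fraction n c / d c is fixed for each [c] in [L]; the choices need not be additive or
   multiplicative, but injectivity of [g] makes their values so. *)
pose n c := projT1 (cid (g_frac c)).
have nP c : exists d, d <> 0 /\ g d * c = g (n c) by rewrite /n; case: cid.
pose d c := projT1 (cid (nP c)).
have d0 c : d c <> 0 by rewrite /d; case: cid => ? [].
have dc c : g (d c) * c = g (n c) by rewrite /d; case: cid => ? [].
have gI a a' : g a = g a' -> a = a'.
  by move=> e; apply/eqP; rewrite -subr_eq0; apply/eqP/g_inj; rewrite rmorphB e subrr.
(* Evaluates [b (x) (n / d)] to [b n / d] in the localization of B at P. *)
pose v b c : localization P := ppi (Frac (b * f (n c)) (fP _ (d0 c)) : frac_preRing P).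
move: x0; rewrite -(@ppi0 (tensor_preRing f g)) => /ppiP.
move/(tensor_eq_sum (v := v)); rewrite big_seq1 big_nil -(@ppi0 (frac_preRing P)) /=.
(* The fraction chosen for 1 need not be 1 / 1, but its two terms agree. *)
have nd1 : n 1 = d 1 by apply: gI; rewrite -dc mulr1.
move=> vE; have /ppiP[u Pu] : v x 1 = ppi (frac_of P 0 : frac_preRing P).
  apply: vE => [b b' c|b c c'|a b c].
  - rewrite -(@ppiD (frac_preRing P)).
    by apply/ppiP; apply: frac_eq_ext => /=; ring.
  - rewrite -(@ppiD (frac_preRing P)); apply/ppiP; apply: frac_eq_ext => /=.
    (* The cross-multiplied identity is checked in [L], pulled back to [A] by injectivity of [g],
       and then pushed to [B] by [f]. *)
    have e : n (c + c') * (d c * d c') = (n c * d c' + n c' * d c) * d (c + c').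
      by apply: gI; rewrite !rmorphM rmorphD !rmorphM -!dc; ring.
    transitivity (b * f (n (c + c') * (d c * d c'))); first by rewrite !rmorphM; ring.
    by rewrite e !rmorphM rmorphD !rmorphM; ring.
  - apply/ppiP; apply: frac_eq_ext => /=.
    have e : a * n c * d (g a * c) = n (g a * c) * d c.
      by apply: gI; rewrite !rmorphM -!dc; ring.
    transitivity (b * f (a * n c * d (g a * c))); first by rewrite !rmorphM; ring.
    by rewrite e !rmorphM; ring.
rewrite /= mul0r subr0 mulr1 nd1 => ux; exists (u * f (d 1)).
  exact: denM_subproof Pu (fP _ (d0 1)).
by rewrite -mulrA [f _ * x]mulrC.
Qed.

(** Primes of the fibre contract to primes of [B] lying over zero, with the same local rings. *)
Lemma generic_fiber_regular : noetherian B ->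
  (forall Q : primeIdeal B, f @^-1` Q = [set 0] -> regular_local (localization Q)) ->
  regular_ring (tensor f g).
Proof.
move=> noeB regB; have loc := tensor_inl_localization_like; split=> [|Q].
  exact: (noetherian_loc_like loc).
by apply: (regular_local_loc_like loc); apply/regB/prime_preim_tensor_inl.
Qed.

End GenericFiber.

(** * Characteristic zero, universal catenarity, and the theorem *)

Lemma purely_inseparable_pchar0 (F : fieldType) (L : fieldExtType F) (x : L) :
  [pchar F] =i pred0 -> purely_inseparable (1%AS : {subfield L}) {:L} ->
  exists c, x = in_alg L c.
Proof.
move=> F0 /purely_inseparableP/(_ x (memvf x))/purely_inseparable_elementP_pchar.
move=> [n n_nat]; have -> : n = 1%N.
  apply/eqP; rewrite eqn_leq; case/andP: n_nat => -> n_all; rewrite andbT leqNgt.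
  (* All prime factors of [n] are characteristics of [L], hence of [F], which has none. *)
  apply/negP => n_gt1; have := allP n_all (pdiv n).
  by rewrite mem_primes pdiv_prime // pdiv_dvd (ltnW n_gt1) pchar_lalg F0 => /(_ isT).
by rewrite expr1 => /vlineP[c ->]; exists c.
Qed.

(** [A] is a finitely generated algebra over itself through the identity, with an empty list of
    generators. *)
Lemma universally_catenary_catenary (A : comPzRingType) :
  universally_catenary A -> catenary A.
Proof.
move=> /(_ A idfun); apply; exists [::] => S _ rangeS _.
by apply/seteqP; split=> // x _; apply: rangeS; exists x.
Qed.

Theorem mainTheorem5 (T : comPzRingType) (M : ideal T)
    (T_local : local_ring M) (T_complete : adically_complete M)
    (T_integers : no_integer_zero_divisor T)
    (M_notin_Ass : ~ Ass T M)
    (T_dim : exists P : primeIdeal T, minimal_prime P /\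
       exists d e : nat, [/\ krull_dim (quot_ring P) d, krull_dim T e & (1 < d < e)%N])
    (A : idomainType) (m : ideal A)
    (A_local : local_ring m) (A_noncatenary : ~ catenary A)
    (psi : {rmorphism completion m -> T}) (psi_iso : bijective psi)
    (A_fibers : forall P : primeIdeal A, ideal_set P <> [set 0] ->
       fiber_isom_residue_field (base_map psi) P)
    (A_generic : [set P : primeIdeal T | base_map psi @^-1` P = [set 0]] = below_Ass T)
    (A_quotients : forall I : ideal A, ideal_set I <> [set 0] ->
       adically_complete (ext_ideal (quot_map I) m)) :
  [/\ ~ excellent m,
      quasi_excellent m <->
        (forall L : fieldExtType (residue_field (zero_prime A)),
           purely_inseparable_ext L ->
           regular_ring (tensor (base_map psi) (residue_ext_map L)))
    & [pchar residue_field (zero_prime A)] =i pred0 ->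
      (forall Q : primeIdeal T, below_Ass T Q -> regular_local (localization Q)) ->
      quasi_excellent m].
Proof.
have qeE : quasi_excellent m <-> forall (P : primeIdeal A)
    (L : fieldExtType (residue_field P)), purely_inseparable_ext L ->
    regular_ring (tensor (base_map psi) (residue_ext_map L)).
  by split=> qe P L Lins; apply/(regular_tensor_bij _ _ psi_iso)/qe.
have qe0 : quasi_excellent m <->
    forall L : fieldExtType (residue_field (zero_prime A)),
      purely_inseparable_ext L ->
      regular_ring (tensor (base_map psi) (residue_ext_map L)).
  rewrite qeE; split=> [qe L|qe P]; first exact: qe.
  case: (pselect (ideal_set P = [set 0])) => [P0|P0 L _].
    (* The type of [L] depends on [P], so equality of records is required, not only of underlying
       sets. *)
    by have -> : P = zero_prime A by apply: primeIdeal_eq.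
  exact/trivial_fiber_regular/A_fibers.
split=> // [[_ /universally_catenary_catenary]|char0 regG] //.
apply/qe0 => L Lins; have [noeT _ _] := T_local.
(* What remains: [A] embeds in [L], elements of [L] are fractions over [A], and primes of [T] over
   zero, being in [below_Ass T], have regular local rings. *)
apply: generic_fiber_regular => // [a ga0|c|Q Q0].
- apply/(residue_map_eq0 (zero_prime A) a)/(fmorph_inj (in_alg L)).
  by rewrite rmorph0.
- have [c' ->] := purely_inseparable_pchar0 c char0 Lins.
  have [n [d [d0 dc]]] := residue_frac c'; exists n, d; split=> //.
  by rewrite -[RHS]/(in_alg L (residue_map _ n)) -dc rmorphM.
- by apply: regG; rewrite -A_generic.
Qed.
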